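(* Let $k$ be a field, let $f: X \dashrightarrow Y$ be a rational map of affine varieties over $k$, and let $C$ be a constructible subset of $X$. Then the set-theoretic image $f(C)$ is a constructible subset of $Y$.
   Context: Affine varieties over $k$ are Zariski-closed subsets $X \subseteq \mathbb{A}_k^n$, $Y\subseteq \mathbb{A}_k^m$, taken with their reduced structure (not necessarily irreducible); the underlying topological spaces are the prime spectra of their coordinate rings with the Zariski topology, and $k$ is not assumed to be algebraically closed. A rational map $f$ is given in coordinates by rational functions $b_i = f_i = p_i/q_i$, $i=1,\ldots,m$; for a subset $C \subseteq X$, $f(C)$ denotes the set of images of the points of $C$ at which $f$ is defined (set-theoretic image). A subset of a topological space is locally closed if it is the intersection of an open and a closed subset; it is constructible if it is a finite union of locally closed subsets. *)

(* Defs.v *)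
From HB Require Import structures.
From mathcomp Require Import all_boot all_algebra.
From mathcomp Require Import generic_quotient ring_quotient fraction.
From mathcomp Require Import boolp classical_sets topology_structure.
From mathcomp Require Import mpoly.

Set Implicit Arguments.
Unset Strict Implicit.
Unset Printing Implicit Defensive.

Import GRing.Theory.
Local Open Scope classical_set_scope.
Local Open Scope ring_scope.
Local Open Scope quotient_scope.

Section Constructible.
Variable T : topologicalType.

Definition locally_closed (L : set T) : Prop :=
  exists U Z : set T, [/\ open U, closed Z & L = U `&` Z].

Definition constructible (C : set T) : Prop :=
  exists (r : nat) (L : 'I_r -> set T),
    (forall i, locally_closed (L i)) /\ C = \bigcup_i L i.

End Constructible.

(* Ideals are not required to be proper and rings may be zero, as in the
   coordinate ring of the empty variety; the quotients of [ring_quotient]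
   only cover proper ideals, hence the ring structure rebuilt below. *)
Record ideal (R : comPzRingType) := Ideal {
  ideal_set :> R -> Prop;
  ideal_has0 : ideal_set 0;
  ideal_add : forall x y, ideal_set x -> ideal_set y -> ideal_set (x + y);
  ideal_mul : forall a x, ideal_set x -> ideal_set (a * x)
}.

Section QuotientRing.
Variables (R : comPzRingType) (I : ideal R).

Definition in_ideal : {pred R} := fun x => `[< I x >].

Lemma in_idealP x : reflect (I x) (x \in in_ideal).
Proof. exact: asboolP. Qed.

Lemma in_ideal_zmod_closed : zmod_closed in_ideal.
Proof.
split=> [|x y /in_idealP Ix /in_idealP Iy]; apply/in_idealP.
  exact: ideal_has0.
by apply: ideal_add => //; rewrite -mulN1r; apply: ideal_mul.
Qed.

HB.instance Definition _ :=
  GRing.isZmodClosed.Build R in_ideal in_ideal_zmod_closed.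

Definition quotring := Quotient.quot in_ideal.
HB.instance Definition _ := GRing.Zmodule.on quotring.
HB.instance Definition _ := EqQuotient.on quotring.

Definition quotproj (x : R) : quotring := \pi_quotring x.

Lemma quotprojP x y : quotproj x = quotproj y <-> I (x - y).
Proof.
by split=> [/eqP|H]; [rewrite -Quotient.idealrBE => /in_idealP|
  apply/eqP; rewrite -Quotient.idealrBE; apply/in_idealP].
Qed.

Lemma quotproj_zmod_morphism : zmod_morphism quotproj.
Proof. by move=> x y; rewrite /quotproj !piE. Qed.

HB.instance Definition _ :=
  GRing.isZmodMorphism.Build R quotring quotproj quotproj_zmod_morphism.

Definition quot_one : quotring := quotproj 1.
Definition quot_mul (a b : quotring) : quotring := quotproj (repr a * repr b).

Lemma quotprojM x y : quotproj (x * y) = quot_mul (quotproj x) (quotproj y).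
Proof.
have reprP z : I (z - repr (quotproj z)).
  by apply/quotprojP; rewrite /quotproj reprK.
apply/quotprojP; set x' := repr _; set y' := repr _.
have -> : x * y - x' * y' = y * (x - x') + x' * (y - y').
  by rewrite !mulrBr (mulrC y x) (mulrC y x') addrA subrK.
by apply: ideal_add; apply: ideal_mul; apply: reprP.
Qed.

Lemma quotproj_repr a : a = quotproj (repr a).
Proof. by rewrite /quotproj reprK. Qed.

Lemma quot_mulA : associative quot_mul.
Proof.
move=> a b c; rewrite (quotproj_repr a) (quotproj_repr b) (quotproj_repr c).
by rewrite -!quotprojM mulrA.
Qed.

Lemma quot_mulC : commutative quot_mul.
Proof. by move=> a b; rewrite /quot_mul mulrC. Qed.

Lemma quot_mul1 : left_id quot_one quot_mul.
Proof. by move=> a; rewrite (quotproj_repr a) -quotprojM mul1r. Qed.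

Lemma quot_mulDl : left_distributive quot_mul +%R.
Proof.
move=> a b c; rewrite (quotproj_repr a) (quotproj_repr b) (quotproj_repr c).
by rewrite -raddfD -!quotprojM mulrDl raddfD.
Qed.

HB.instance Definition _ := GRing.Zmodule_isComPzRing.Build quotring
  quot_mulA quot_mulC quot_mul1 quot_mulDl.

Lemma quotproj_monoid_morphism : monoid_morphism quotproj.
Proof. by split=> // x y; rewrite quotprojM. Qed.

HB.instance Definition _ :=
  GRing.isMonoidMorphism.Build R quotring quotproj quotproj_monoid_morphism.

End QuotientRing.

Record spec (R : comPzRingType) := Spec {
  spec_ideal :> ideal R;
  spec_proper : ~ spec_ideal 1;
  spec_prime : forall x y,
    spec_ideal (x * y) -> spec_ideal x \/ spec_ideal y
}.

HB.instance Definition _ (R : comPzRingType) := gen_eqMixin (spec R).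
HB.instance Definition _ (R : comPzRingType) := gen_choiceMixin (spec R).

Definition zero_locus (R : comPzRingType) (S : set R) : set (spec R) :=
  [set P : spec R | forall x, S x -> P x].

Section Zariski.
Variable R : comPzRingType.

Definition zariski_open (U : set (spec R)) : Prop :=
  exists S : set R, U = ~` zero_locus S.

Lemma zariski_openT : zariski_open setT.
Proof.
exists [set 1]; apply/esym/seteqP; split=> // P _ /= P1.
by apply: (spec_proper (P1 1 _)).
Qed.

Lemma zariski_openI : setI_closed zariski_open.
Proof.
move=> _ _ [S ->] [T ->].
exists [set z | exists x y, [/\ S x, T y & z = x * y]].
rewrite -setCU; congr (~` _); apply/seteqP; split=> P /=.
  case=> H z [x [y [Sx Ty ->]]]; last exact/ideal_mul/H.
  by rewrite mulrC; apply/ideal_mul/H.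
move=> H; case: (pselect (forall x, S x -> P x)) => [|nS]; first by left.
right=> y Ty; apply: contrapT => nPy; apply: nS => x Sx.
by case: (@spec_prime _ P x y) => //; apply: H; exists x, y.
Qed.

Lemma zariski_open_bigU (J : Type) (F : J -> set (spec R)) :
  (forall j, zariski_open (F j)) -> zariski_open (\bigcup_j F j).
Proof.
move=> /choice[S FS]; exists (\bigcup_j S j).
rewrite (eq_bigcupr (fun j _ => FS j)) -setC_bigcap; congr (~` _).
apply/seteqP; split=> P /= H; first by move=> x [j _ Sx]; apply: (H j).
by move=> j _ x Sx; apply: H; exists j.
Qed.

HB.instance Definition _ := isOpenTopological.Build (spec R)
  zariski_openT zariski_openI zariski_open_bigU.

End Zariski.

(* [quotring P] again, with the additional structure due to [P] being prime *)
Definition domquot (R : comPzRingType) (P : spec R) := quotring P.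

Section ResidueField.
Variables (R : comPzRingType) (P : spec R).

HB.instance Definition _ := GRing.ComPzRing.on (domquot P).

Definition domproj : R -> domquot P := @quotproj R P.
HB.instance Definition _ := GRing.RMorphism.on domproj.

Lemma domproj_eq0 x : domproj x = 0 <-> P x.
Proof. by rewrite -(raddf0 (@quotproj R P)) quotprojP subr0. Qed.

Lemma domquot_nz : (1 : domquot P) != 0.
Proof.
apply/eqP; rewrite -(rmorph1 domproj) domproj_eq0; exact: spec_proper.
Qed.

HB.instance Definition _ :=
  GRing.PzSemiRing_isNonZero.Build (domquot P) domquot_nz.

Definition dom_unit : {pred domquot P} := fun x => `[< exists y, y * x = 1 >].

Definition dom_inv (x : domquot P) : domquot P :=
  if pselect (exists y, y * x = 1) is left e then projT1 (cid e) else x.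

Lemma dom_mulVx : {in dom_unit, left_inverse 1 dom_inv *%R}.
Proof.
move=> x /asboolP ex; rewrite /dom_inv; case: pselect => // e.
by case: (cid e).
Qed.

Lemma dom_unitPl (x y : domquot P) : y * x = 1 -> dom_unit x.
Proof. by move=> yx; apply/asboolP; exists y. Qed.

Lemma dom_inv_out : {in [predC dom_unit], dom_inv =1 id}.
Proof.
move=> x /negP nx; rewrite /dom_inv; case: pselect => // e.
by case: nx; apply/asboolP.
Qed.

HB.instance Definition _ := GRing.ComNzRing_hasMulInverse.Build (domquot P)
  dom_mulVx dom_unitPl dom_inv_out.

Lemma dom_integral : GRing.integral_domain_axiom (domquot P).
Proof.
move=> a b; rewrite (quotproj_repr a) (quotproj_repr b).
rewrite -!/(domproj _) -rmorphM => /domproj_eq0/spec_prime.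
by case=> /domproj_eq0 ->; rewrite eqxx ?orbT.
Qed.

HB.instance Definition _ :=
  GRing.ComUnitRing_isIntegral.Build (domquot P) dom_integral.

Definition residue_field : fieldType := {fraction (domquot P)}.

Definition residue (x : R) : residue_field := tofrac (domproj x).
HB.instance Definition _ := GRing.RMorphism.copy residue (@tofrac _ \o domproj).

End ResidueField.

Section PointMaps.

Definition comap_ideal (R S : comPzRingType) (f : {rmorphism R -> S})
  (I : ideal S) : ideal R.
Proof.
exists (f @^-1` I); rewrite /preimage /=.
- by rewrite rmorph0; apply: ideal_has0.
- by move=> x y Ix Iy; rewrite rmorphD; apply: ideal_add.
- by move=> a x Ix; rewrite rmorphM; apply: ideal_mul.
Defined.

Definition comap (R S : comPzRingType) (f : {rmorphism R -> S})
  (P : spec S) : spec R.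
Proof.
exists (comap_ideal f P); rewrite /= /preimage /=.
- by rewrite rmorph1; apply: spec_proper.
- by move=> x y; rewrite rmorphM; apply: spec_prime.
Defined.

Definition ker_ideal (R S : comPzRingType) (f : {rmorphism R -> S}) : ideal R.
Proof.
exists [set x | f x = 0] => /=.
- exact: rmorph0.
- by move=> x y fx fy; rewrite rmorphD fx fy addr0.
- by move=> a x fx; rewrite rmorphM fx mulr0.
Defined.

Definition ker_point (R : comPzRingType) (F : fieldType)
  (f : {rmorphism R -> F}) : spec R.
Proof.
exists (ker_ideal f) => /=.
- by rewrite rmorph1; apply/eqP/oner_neq0.
- by move=> x y; rewrite rmorphM => /eqP; rewrite mulf_eq0 => /orP[]/eqP; tauto.
Defined.

End PointMaps.

Notation affine_space k n := (spec {mpoly k[n]}).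

Record affvar (k : fieldType) (n : nat) := AffVar {
  affvar_set :> set (affine_space k n);
  affvar_closed : closed affvar_set
}.

Definition vanishing_ideal (R : comPzRingType) (X : set (spec R)) : ideal R.
Proof.
exists [set g | forall P, X P -> P g] => /=.
- by move=> P _; apply: ideal_has0.
- by move=> x y Ix Iy P XP; apply: ideal_add; [apply: Ix|apply: Iy].
- by move=> a x Ix P XP; apply: ideal_mul; apply: Ix.
Defined.

Section Variety.
Variables (k : fieldType) (n : nat) (X : affvar k n).

Definition coordring := quotring (vanishing_ideal X).
HB.instance Definition _ := GRing.ComPzRing.on coordring.

Definition coordproj : {mpoly k[n]} -> coordring :=
  @quotproj _ (vanishing_ideal X).
HB.instance Definition _ := GRing.RMorphism.on coordproj.

Definition ambient_point : spec coordring -> affine_space k n :=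
  comap coordproj.

Definition scalar_at (P : spec coordring) : k -> residue_field P :=
  residue P \o coordproj \o @mpolyC n k.
HB.instance Definition _ P := GRing.RMorphism.on (scalar_at P).

End Variety.

(* An element num/den of the total ring of fractions of [A]. *)
Record ratfun (A : comPzRingType) := RatFun {
  ratnum : A;
  ratden : A;
  ratden_reg : GRing.lreg ratden
}.

(* [b] is defined at [P] when it has some expression a/s with s nonzero at [P],
   not necessarily the given one; its value is then that of a/s in the residue
   field, and does not depend on a and s. *)
Definition ratfun_value (A : comPzRingType) (b : ratfun A) (P : spec A)
    (v : residue_field P) : Prop :=
  exists a s : A, [/\ GRing.lreg s, a * ratden b = ratnum b * s, ~ P s
    & v = residue P a / residue P s].

(* The point of affine m-space with coordinates [v]: the prime ideal of the
   polynomials vanishing at [v]. *)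
Definition point_of_coords (k : fieldType) (n m : nat) (X : affvar k n)
    (P : spec (coordring X)) (v : 'I_m -> residue_field P) :
    affine_space k m :=
  ker_point (mmap (scalar_at P) v).

(* [ratfun_image b P Q]: the b_i are all defined at [P], with image [Q]. *)
Definition ratfun_image (k : fieldType) (n m : nat) (X : affvar k n)
    (b : 'I_m -> ratfun (coordring X)) (P : spec (coordring X))
    (Q : affine_space k m) : Prop :=
  exists v : 'I_m -> residue_field P,
    (forall i, ratfun_value (b i) (v i)) /\ Q = point_of_coords v.

Record ratmap (k : fieldType) (n m : nat) (X : affvar k n) (Y : affvar k m) :=
  RatMap {
    ratmap_coord :> 'I_m -> ratfun (coordring X);
    ratmap_target : forall P Q, ratfun_image ratmap_coord P Q -> affvar_set Y Q
  }.

Definition ratmap_image (k : fieldType) (n m : nat) (X : affvar k n)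
    (Y : affvar k m) (f : ratmap X Y) (C : set (spec (coordring X))) :
    set (spec (coordring Y)) :=
  [set Q | exists2 P, C P & ratfun_image f P (ambient_point Q)].

(* Main.v *)
(* The argument is Chevalley's theorem, with all constructible sets written as
   Boolean combinations of basic open sets D(g); since k[x_1, ..., x_n] is
   noetherian, these are exactly the topologically constructible ones.

   For one variable, the image of {Q : f_1, ..., f_r in Q, g notin Q} under
   Spec R[x] -> Spec R is computed by pseudo-division.  Where the leading
   coefficient a of f_1 vanishes, f_1 may be truncated; where it does not, f_2
   may be replaced by its remainder modulo f_1.  When a single f is left, with
   leading coefficient nonzero at P, the fibre over P contains a suitable Q iff
   f does not divide a high power of g over the residue field of P, that is,
   iff the remainder of that power modulo f does not vanish at P.

   For a rational map with coordinates b_i, noetherianity gives finitely many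
   expressions b_i = a_ij / s_ij whose domains cover that of b_i.  In the
   spectrum of k[y_1, ..., y_m][x_1, ..., x_n], the graph of the map over C is
   cut out by: x in C, for all i some s_ij(x) != 0, and s_ij(x) y_i = a_ij(x)
   for all i, j.  The image of C is the projection of this graph. *)
Require Import Defs.
From mathcomp Require Import all_boot all_algebra.
From mathcomp Require Import mpoly.
From mathcomp Require Import boolp classical_sets topology_structure.
From mathcomp Require Import ring.

Set Implicit Arguments.
Unset Strict Implicit.
Unset Printing Implicit Defensive.

Import GRing.Theory.
Local Open Scope classical_set_scope.
Local Open Scope ring_scope.

(** * Ideals and prime ideals *)

Lemma spec_ext (R : comPzRingType) (P Q : spec R) :
  (forall x, P x <-> Q x) -> P = Q.
Proof.
case: P Q => [[I I0 ID IM] I1 Ip] [[J J0 JD JM] J1 Jp] /= eqIJ.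
have eIJ : I = J by apply/funext => x; apply/propext.
subst J; rewrite (Prop_irrelevance J0 I0) in J1 Jp *.
rewrite (Prop_irrelevance JD ID) in J1 Jp *.
rewrite (Prop_irrelevance JM IM) in J1 Jp *.
by rewrite (Prop_irrelevance J1 I1) (Prop_irrelevance Jp Ip).
Qed.

Lemma ideal_sum (R : comPzRingType) (I : ideal R) (J : Type) (r : seq J)
    (P : pred J) (F : J -> R) :
  (forall i, P i -> I (F i)) -> I (\sum_(i <- r | P i) F i).
Proof.
by move=> IF; elim/big_ind: _ => //; [exact: ideal_has0|exact: ideal_add].
Qed.

Lemma ideal_opp (R : comPzRingType) (I : ideal R) x : I x -> I (- x).
Proof. by rewrite -mulN1r; apply: ideal_mul. Qed.

Lemma ideal_sub (R : comPzRingType) (I : ideal R) x y :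
  I x -> I y -> I (x - y).
Proof. by move=> Ix Iy; apply: ideal_add => //; apply: ideal_opp. Qed.

Lemma ideal_subl (R : comPzRingType) (I : ideal R) x y :
  I (x - y) -> I y <-> I x.
Proof.
move=> Ixy; split=> [Iy|Ix]; first by rewrite -(subrK y x); apply: ideal_add.
by rewrite -(subKr x y); apply: ideal_sub.
Qed.

Lemma ideal_mulr (R : comPzRingType) (I : ideal R) a x : I x -> I (x * a).
Proof. by rewrite mulrC; apply: ideal_mul. Qed.

Lemma spec_mul (R : comPzRingType) (P : spec R) x y :
  P (x * y) <-> P x \/ P y.
Proof.
split; first exact: spec_prime.
by case; [exact: ideal_mulr|exact: ideal_mul].
Qed.

Lemma spec_exp (R : comPzRingType) (P : spec R) x n : P (x ^+ n) -> P x.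
Proof.
elim: n => [/spec_proper //|n IHn]; rewrite exprS => /spec_prime.
by case.
Qed.

(** * Constructible sets in algebraic form *)

Definition basic_open (R : comPzRingType) (g : R) : set (spec R) :=
  [set P | ~ P g].

(** Avoiding the topology gives an induction principle and makes stability under preimages
    immediate. It implies [constructible] over any ring; the converse is obtained over noetherian
    rings. *)
Inductive fconstructible (R : comPzRingType) : set (spec R) -> Prop :=
| fc_basic g : fconstructible (basic_open g)
| fc_setC E : fconstructible E -> fconstructible (~` E)
| fc_setU E F :
    fconstructible E -> fconstructible F -> fconstructible (E `|` F).

Section FConstructible.
Variable R : comPzRingType.
Implicit Types E F : set (spec R).

Lemma fc_setI E F :
  fconstructible E -> fconstructible F -> fconstructible (E `&` F).
Proof.
move=> fE fF; rewrite -[E `&` F]setCK setCI.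
by apply: fc_setC; apply: fc_setU; apply: fc_setC.
Qed.

Lemma fc_vanish (g : R) : fconstructible [set P : spec R | P g].
Proof. by rewrite -[X in fconstructible X]setCK; apply/fc_setC/fc_basic. Qed.

Lemma fc_set0 : fconstructible (set0 : set (spec R)).
Proof.
have -> : set0 = basic_open (0 : R); last exact: fc_basic.
by apply/seteqP; split=> // P /=; apply; exact: ideal_has0.
Qed.

Lemma fc_exists (J : eqType) (s : seq J) (F : J -> set (spec R)) :
  (forall j, j \in s -> fconstructible (F j)) ->
  fconstructible [set P | exists2 j, j \in s & F j P].
Proof.
elim: s => [|j s IHs] fF.
  suff -> : [set P | exists2 j, j \in [::] & F j P] = set0 by exact: fc_set0.
  by apply/seteqP; split=> // P [].
have -> : [set P | exists2 j0, j0 \in j :: s & F j0 P]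
          = F j `|` [set P | exists2 j0, j0 \in s & F j0 P].
  apply/seteqP; split=> P /=.
    by case=> i; rewrite in_cons => /orP[/eqP-> ?|? ?]; [left|right; exists i].
  case=> [?|[i si ?]]; first by exists j; rewrite ?mem_head.
  by exists i; rewrite // in_cons si orbT.
apply: fc_setU; first by apply: fF; rewrite mem_head.
by apply: IHs => i si; apply: fF; rewrite in_cons si orbT.
Qed.

Lemma fc_forall (J : eqType) (s : seq J) (F : J -> set (spec R)) :
  (forall j, j \in s -> fconstructible (F j)) ->
  fconstructible [set P | forall j, j \in s -> F j P].
Proof.
move=> fF; rewrite -[X in fconstructible X]setCK; apply: fc_setC.
have -> : ~` [set P | forall j, j \in s -> F j P]
          = [set P | exists2 j, j \in s & (~` F j) P].
  apply/seteqP; split=> P /=; last by case=> j sj nF /(_ j sj).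
  by move=> nH; apply: contrapT => nE; apply: nH => j sj; apply: contrapT => nF;
    apply: nE; exists j.
by apply: fc_exists => j sj; apply/fc_setC/fF.
Qed.

Definition basic_set (sg : seq R * R) : set (spec R) :=
  [set P | (forall x, x \in sg.1 -> P x) /\ ~ P sg.2].

Definition basic_union (l : seq (seq R * R)) : set (spec R) :=
  [set P | exists2 sg, sg \in l & basic_set sg P].

Lemma basic_unionU l1 l2 :
  basic_union l1 `|` basic_union l2 = basic_union (l1 ++ l2).
Proof.
apply/seteqP; split=> P /=; last first.
  by case=> sg; rewrite mem_cat => /orP[?|?] ?; [left|right]; exists sg.
by case=> [[sg ? ?]|[sg ? ?]]; exists sg; rewrite // mem_cat; apply/orP; auto.
Qed.

Lemma basic_unionI l1 l2 :
  basic_union l1 `&` basic_union l2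
  = basic_union [seq (x.1 ++ y.1, x.2 * y.2) | x <- l1, y <- l2].
Proof.
apply/seteqP; split=> P /=.
  case=> [[x l1x [Px nPx]] [y l2y [Py nPy]]].
  exists (x.1 ++ y.1, x.2 * y.2); first exact: allpairs_f.
  split=> /= [z|]; first by rewrite mem_cat => /orP[/Px|/Py].
  by case/spec_prime.
case=> _ /allpairsP[[x y] /= [l1x l2y ->]] [/= Pxy nPxy].
split; [exists x|exists y] => //; split.
- by move=> z xz; apply: Pxy; rewrite mem_cat xz.
- by move=> Pg; apply: nPxy; apply: ideal_mulr.
- by move=> z xz; apply: Pxy; rewrite mem_cat xz orbT.
- by move=> Pg; apply: nPxy; apply: ideal_mul.
Qed.

(** The complement is put in normal form at the same time, so that the case of [fc_setC] only swaps
    the two halves. *)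
Lemma fc_normal_form E : fconstructible E ->
  (exists l, E = basic_union l) /\ (exists l, ~` E = basic_union l).
Proof.
elim=> [g|F _ [[l1 e1] [l2 e2]]|F G _ [[l1 e1] [l2 e2]] _ [[l3 e3] [l4 e4]]].
(* D(g) carries no equation; V(g) is paired with D(1), which is the whole spectrum. *)
- split; [exists [:: ([::], g)]|exists [:: ([:: g], 1)]];
    apply/seteqP; split=> P /=.
  + by move=> nPg; exists ([::], g); rewrite ?mem_head.
  + by case=> _ /[!inE]/eqP-> [].
  + move=> /contrapT Pg; exists ([:: g], 1); rewrite ?mem_head //.
    split; last exact: spec_proper.
    by move=> x /[!inE]/eqP->.
  + by case=> _ /[!inE]/eqP-> [/= Pg _]; apply; apply: Pg; rewrite mem_head.
- by rewrite setCK; split; [exists l2|exists l1].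
- split; first by eexists; rewrite e1 e3 basic_unionU.
  by eexists; rewrite setCU e2 e4 basic_unionI.
Qed.

End FConstructible.

Lemma fc_preimage (R S : comPzRingType) (f : {rmorphism R -> S})
    (E : set (spec R)) : fconstructible E -> fconstructible (comap f @^-1` E).
Proof.
by elim=> [g|F _|F G _ fF _]; [exact: (fc_basic (f g))|exact: fc_setC
  |exact: fc_setU].
Qed.

Lemma open_basic (R : comPzRingType) (g : R) : open (basic_open g).
Proof.
exists [set g]; apply/seteqP; split=> P /= nP.
  by apply: contra_not nP; apply.
by move=> Pg; apply: nP => x ->.
Qed.

Lemma constructible_fc (R : comPzRingType) (E : set (spec R)) :
  fconstructible E -> constructible E.
Proof.
case/fc_normal_form=> [[l ->] _].
(* The default [([::], 0)] is never reached, since [i] is below [size l]. *)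
exists (size l), (fun i => basic_set (nth ([::], 0) l i)); split.
  move=> i; case: (nth _ _ _) => s g.
  exists (basic_open g), (zero_locus [set` s]); split; first exact: open_basic.
    by rewrite -openC; exists [set` s].
  by rewrite setIC; apply/seteqP; split=> P [? ?].
apply/seteqP; split=> P /=.
  case=> sg lsg Psg; have lt_i := lsg; rewrite -index_mem in lt_i.
  by exists (Ordinal lt_i); rewrite //= nth_index.
by case=> i _ Pi; exists (nth ([::], 0) l i); rewrite ?mem_nth.
Qed.

Lemma locally_closed_preimage (R S : comPzRingType) (f : {rmorphism R -> S})
    (L : set (spec R)) : locally_closed L -> locally_closed (comap f @^-1` L).
Proof.
have open_pre U : open U -> open (comap f @^-1` U).
  case=> T ->; exists (f @` T); apply: (congr1 setC).
  apply/seteqP; split=> P /=; first by move=> TP _ [x Tx <-]; apply: TP.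
  by move=> TP x Tx; apply: TP; exists x.
case=> U [Z [oU cZ ->]]; exists (comap f @^-1` U), (comap f @^-1` Z).
split=> //.
- exact: open_pre.
- by rewrite -openC; apply: (open_pre (~` Z)); rewrite openC.
Qed.

Lemma constructible_preimage (R S : comPzRingType) (f : {rmorphism R -> S})
    (E : set (spec R)) : constructible E -> constructible (comap f @^-1` E).
Proof.
case=> r [L [lcL ->]]; exists r, (fun i => comap f @^-1` L i); split.
  by move=> i; apply: locally_closed_preimage.
by rewrite preimage_bigcup.
Qed.

(** * Ring maps satisfying Chevalley's theorem *)

Definition chevalley (R S : comPzRingType) (f : {rmorphism R -> S}) : Prop :=
  forall E : set (spec S), fconstructible E -> fconstructible (comap f @` E).

(** Images commute with unions, so the normal form reduces the claim to basic sets. *)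
Lemma chevalley_basic (R S : comPzRingType) (f : {rmorphism R -> S}) :
  (forall s g, fconstructible (comap f @` basic_set (s, g))) -> chevalley f.
Proof.
move=> fs _ /fc_normal_form[[l ->] _].
have -> : comap f @` basic_union l
          = [set P | exists2 sg, sg \in l & (comap f @` basic_set sg) P].
  apply/seteqP; split=> P /=.
    by case=> Q [sg lsg Qsg] <-; exists sg => //; exists Q.
  by case=> sg lsg [Q Qsg <-]; exists Q => //; exists sg.
by apply: fc_exists => -[s g] _.
Qed.

Lemma chevalley_comp (R S T : comPzRingType) (f : {rmorphism R -> S})
    (g : {rmorphism S -> T}) : chevalley f -> chevalley g -> chevalley (g \o f).
Proof.
move=> cf cg E /cg/cf; rewrite image_comp.
by congr fconstructible; apply: eq_imagel => P _; apply: spec_ext.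
Qed.

Lemma chevalley_id (R : comPzRingType) : chevalley (@idfun R).
Proof.
move=> E; congr fconstructible; rewrite -[LHS]image_id.
by apply: eq_imagel => P _; apply: spec_ext.
Qed.

(** The map [comap h] has the section [comap r], hence is onto; so [E] and its preimage under
    [comap h] have the same image in [spec R]. *)
Lemma chevalley_retract (R S S' : comPzRingType) (f : {rmorphism R -> S})
    (f' : {rmorphism R -> S'}) (h : {rmorphism S -> S'})
    (r : {rmorphism S' -> S}) :
  cancel h r -> h \o f =1 f' -> chevalley f' -> chevalley f.
Proof.
move=> hK hf cf' E fE; have := cf' _ (fc_preimage h fE).
congr fconstructible; apply/seteqP; split=> P /=.
  case=> Q EQ <-; exists (comap h Q) => //.
  by apply: spec_ext => x; rewrite /= /preimage /= -hf.
case=> Q EQ <-; exists (comap r Q); rewrite /preimage /=.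
  suff -> : comap h (comap r Q) = Q by [].
  by apply: spec_ext => x /=; rewrite /preimage /= hK.
by apply: spec_ext => x /=; rewrite /preimage /= -hf /= hK.
Qed.

(** * Projection of the affine line *)

Lemma residue_eq0 (R : comPzRingType) (P : spec R) x : residue P x = 0 <-> P x.
Proof.
rewrite -domproj_eq0 /residue; split=> [/eqP|->]; last exact: rmorph0.
by rewrite tofrac_eq0 => /eqP.
Qed.

Lemma irreducible_factor (K : fieldType) (f : {poly K}) :
  (1 < size f)%N -> exists2 p, irreducible_poly p & p %| f.
Proof.
have [n] := ubnP (size f); elim: n f => // n IHn f lt_fn f_gt1.
have [irr|] := pselect (irreducible_poly f); first by exists f.
move=> red; have [q [q_neq1 q_f q_neq]] :
    exists q : {poly K}, [/\ size q != 1%N, q %| f & ~~ (q %= f)].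
  apply: contrapT => nq; apply: red; split=> // q q1 qf.
  by apply/negPn/negP => q_neq; apply: nq; exists q.
have f0 : f != 0 by rewrite -size_poly_gt0 ltnW.
have q0 : q != 0 by apply: contraTneq q_f => ->; rewrite dvd0p.
have lt_qf : (size q < size f)%N.
  rewrite ltn_neqAle dvdp_leq // andbT; apply: contraNneq q_neq => eq_size.
  by rewrite -dvdp_size_eqp // eq_size.
have [p irr p_q] : exists2 p, irreducible_poly p & p %| q.
  apply: IHn; first exact: leq_trans lt_qf _.
  by rewrite ltn_neqAle eq_sym q_neq1 size_poly_gt0.
by exists p => //; apply: dvdp_trans q_f.
Qed.

(** Irreducible factors of [f] are split off one at a time; each uses up one factor [g] and lowers
    the size of [f]. The exponent depends on the size of [f] only, hence can be chosen uniformly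
    over all residue fields. *)
Lemma dvdp_exp_irreducible (K : fieldType) (f g : {poly K}) : f != 0 ->
  (forall p, irreducible_poly p -> p %| f -> p %| g) ->
  forall n, (size f <= n)%N -> f %| g ^+ n.
Proof.
move=> f0 fg n; elim: n f f0 fg => [|n IHn] f f0 fg le_fn.
  by rewrite leqn0 size_poly_eq0 (negPf f0) in le_fn.
have [f_le1|/irreducible_factor[p irr p_f]] := leqP (size f) 1%N.
  by rewrite (size1_polyC f_le1) /dvdp modpC ?eqxx // -polyC_eq0 -size1_polyC.
move: (p_f) f0 fg le_fn => /dvdpP[q ->]; rewrite mulf_eq0 negb_or.
case/andP=> q0 p0 qpg; rewrite size_mul // => le_n.
rewrite exprSr dvdp_mul //; last by apply: qpg => //; apply: dvdp_mull.
apply: IHn => // [p' irr' p'_q|]; first by apply: qpg => //; apply: dvdp_mulr.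
case: irr => p_gt1 _; rewrite -ltnS; apply: leq_trans le_n.
by case: (size p) p_gt1 => [|[|j]] // _; rewrite addnS /= addnS ltnS leq_addr.
Qed.

Section PolyPoint.
Variables (R : comNzRingType) (P : spec R) (p : {poly residue_field P}).
Hypothesis irr_p : irreducible_poly p.

Let divides (h : {poly R}) : Prop := p %| map_poly (residue P) h.

Let divides_ideal : ideal {poly R}.
Proof.
exists divides; rewrite /divides.
- by rewrite rmorph0 dvdp0.
- by move=> x y px py; rewrite rmorphD dvdp_add.
- by move=> a x px; rewrite rmorphM dvdp_mull.
Defined.

(** This is the preimage of the ideal (p) over the residue field. It is prime since a polynomial not
    divisible by [p] is coprime to [p], and it contracts to [P] since [p], of positive degree,
    divides no nonzero constant. *)
Lemma poly_point : exists2 Q : spec {poly R}, comap polyC Q = P &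
  forall h, Q h <-> p %| map_poly (residue P) h.
Proof.
have Q1 : ~ divides_ideal 1.
  rewrite /= /divides rmorph1 dvdp1; apply/negP.
  by rewrite neq_ltn irr_p.1 orbT.
have Qp x y : divides_ideal (x * y) -> divides_ideal x \/ divides_ideal y.
  rewrite /= /divides rmorphM /=.
  have [|nx pxy] := boolP (p %| map_poly (residue P) x); first by left.
  right; rewrite Gauss_dvdpr // in pxy.
  rewrite coprimep_def; apply: contraNT nx => gcd1.
  apply: dvdp_trans (dvdp_gcdr p _).
  by have := irr_p.2 _ gcd1 (dvdp_gcdl _ _); rewrite /eqp => /andP[].
exists (Spec Q1 Qp) => //; apply: spec_ext => x.
rewrite /= /preimage /= /divides map_polyC /=.
have -> : P x <-> residue P x = 0 by rewrite residue_eq0.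
split=> [|->]; last by rewrite dvdp0.
have [//|x0] := eqVneq (residue P x) 0.
move/dvdp_leq; rewrite polyC_eq0 x0 size_polyC x0 => /(_ isT).
by rewrite leqNgt irr_p.1.
Qed.

End PolyPoint.

(** The generic point of the fibre over [P]: the extension of [P] to R[x] is the kernel of the map
    to the rational functions over the residue field, hence prime. *)
Lemma coef_point (R : comNzRingType) (P : spec R) :
  exists2 Q : spec {poly R}, comap polyC Q = P &
  forall h, Q h <-> forall i, P h`_i.
Proof.
pose f : {rmorphism {poly R} -> {fraction {poly residue_field P}}} :=
  @tofrac _ \o map_poly (residue P).
have fP h : f h = 0 <-> forall i, P h`_i.
  split=> [/eqP|Ph]; rewrite /f /=.
    rewrite tofrac_eq0 => /eqP/polyP h0 i; apply/residue_eq0.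
    by have := h0 i; rewrite coef_map coef0.
  apply/eqP; rewrite tofrac_eq0; apply/eqP/polyP => i.
  by rewrite coef_map coef0; apply/residue_eq0.
exists (ker_point f) => //; apply: spec_ext => x; rewrite /= /preimage /=.
rewrite -[X in X <-> _]/(f x%:P = 0) fP; split=> [/(_ 0)|Px i].
  by rewrite coefC eqxx.
by rewrite coefC; case: eqP => // _; apply: ideal_has0.
Qed.

Section PolyStep.
Variable R : comNzRingType.
Implicit Types (f g : {poly R}) (s : seq {poly R}) (P : spec R).

Local Notation img s g := (comap polyC @` basic_set (s, g)).
Local Notation rmodp := Pdiv.CommonRing.rmodp.
Local Notation rdivp := Pdiv.CommonRing.rdivp.
Local Notation rscalp := Pdiv.CommonRing.rscalp.

Lemma poly_in_point (Q : spec {poly R}) f :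
  (forall i, Q (f`_i)%:P) -> Q f.
Proof.
move=> Qf; rewrite -[f]coefK poly_def; apply: ideal_sum => i _.
by rewrite -mul_polyC; apply: ideal_mulr.
Qed.

(** Pseudo-division multiplies [g] by a power of the leading coefficient of [f] before subtracting a
    multiple of [f]; modulo [Q] that power is nonzero and the multiple vanishes. *)
Lemma rmodp_in_point (Q : spec {poly R}) f g :
  ~ Q (lead_coef f)%:P -> Q f -> Q (rmodp g f) <-> Q g.
Proof.
move=> nQa Qf; have /esym/(canRL (addKr _)) -> := Pdiv.ComRing.rdivp_eq f g.
rewrite addrC; set a := _ *: g.
have -> : Q g <-> Q a.
  rewrite /a -mul_polyC rmorphXn spec_mul.
  by split=> [|[/spec_exp|]]; [right|move/nQa|].
apply: ideal_subl; rewrite opprB addrC subrK; exact: ideal_mul.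
Qed.

(** A prime containing all coefficients of [g] contains [g]; conversely, the generic point of the
    fibre avoids [g] once some coefficient lies outside [P]. *)
Lemma polyC_image_nil g :
  img [::] g = [set P | exists2 i, i \in iota 0 (size g) & basic_open g`_i P].
Proof.
apply/seteqP; split=> P /=.
  case=> Q [_ /= nQg] <-; apply: contrapT => nE; apply: nQg.
  apply: poly_in_point => i; have [lt_ig|] := ltnP i (size g); last first.
    by move/(nth_default 0)->; apply: ideal_has0.
  by apply: contrapT => nQ; apply: nE; exists i; rewrite ?mem_iota.
case=> i _ nPi; have [Q QP Qg] := coef_point P.
by exists Q => //; split=> //= /Qg/(_ i).
Qed.

(** Where the leading coefficient of [f] is nonzero, [f] keeps its size over the residue field, so
    the exponent [size f] is large enough for [dvdp_exp_irreducible]. If [r] is nonzero there, some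
    irreducible factor of [f] does not divide [g] and defines a point of the fibre. *)
Lemma polyC_image_single f g : let r := rmodp (g ^+ size f) f in
  basic_open (lead_coef f) `&` img [:: f] g =
  basic_open (lead_coef f)
    `&` [set P | exists2 i, i \in iota 0 (size r) & basic_open r`_i P].
Proof.
move=> r; apply/seteqP; split=> P /= [nPa].
  case=> Q [Qs /= nQg] eQP; split=> //; apply: contrapT => nE; apply: nQg.
  apply: (@spec_exp _ _ _ (size f)).
  have Qf : Q f by apply: Qs; rewrite mem_head.
  apply/(rmodp_in_point _ _ Qf); first by move: nPa; rewrite -eQP.
  apply: poly_in_point => i; have [lt_i|] := ltnP i (size r); last first.
    by move/(nth_default 0)->; apply: ideal_has0.
  apply: contrapT => nQ; apply: nE; exists i; rewrite ?mem_iota //.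
  by rewrite -eQP.
case=> i _ nPi; split=> //.
pose h : {rmorphism {poly R} -> {poly residue_field P}} := map_poly (residue P).
have a0 : residue P (lead_coef f) != 0 by apply/eqP => /residue_eq0.
have size_f : size (h f) = size f.
  by rewrite /h size_map_poly_id0.
have f0 : h f != 0.
  by rewrite -lead_coef_eq0 /h lead_coef_map_id0 ?rmorph0.
(* Otherwise [f] divides [g ^+ size f], hence also [r], over the residue field; as [r] is shorter
   than [f], it would vanish. *)
have [p irr_p [p_f p_g]] : exists2 p,
    irreducible_poly p & p %| h f /\ ~~ (p %| h g).
  apply: contrapT => np; apply: nPi; apply/residue_eq0.
  have /dvdp_exp_irreducible/(_ _ (leqnn _)) : forall p, irreducible_poly p ->
      p %| h f -> p %| h g.
    move=> p irr_p p_f; apply/negPn/negP => p_g; apply: np.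
    by exists p.
  move=> /(_ f0); rewrite size_f -rmorphXn => f_dvd.
  have f_r : h f %| h r.
    have /(congr1 h) := Pdiv.ComRing.rdivp_eq f (g ^+ size f).
    rewrite -mul_polyC rmorphD !rmorphM => /esym/(canRL (addKr _)) ->.
    by rewrite dvdp_add ?dvdpNr ?dvdp_mull.
  have : (size (h r) < size (h f))%N.
    rewrite (leq_ltn_trans (size_poly _ _)) // size_f Pdiv.Ring.ltn_rmodp.
    by apply: contraNneq f0 => ->; rewrite /h rmorph0.
  rewrite ltnNge; have [hr0 _|hr0] := eqVneq (h r) 0; last by rewrite dvdp_leq.
  by rewrite -coef_map -/h hr0 coef0.
have [Q QP Qh] := poly_point irr_p.
exists Q => //; split=> [x /[!inE]/eqP->|] /=; first exact/Qh.
by move/Qh; apply/negP.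
Qed.

Lemma polyC_image_zero s g : img (0 :: s) g = img s g.
Proof.
congr image; apply/seteqP; split=> Q [Qs nQg]; split=> // x.
  by move=> sx; apply: Qs; rewrite in_cons sx orbT.
by rewrite in_cons => /orP[/eqP->|/Qs //]; apply: ideal_has0.
Qed.

Lemma polyC_image_perm s1 s2 g : s1 =i s2 -> img s1 g = img s2 g.
Proof.
move=> s12; congr image; apply/seteqP; split=> Q [Qs nQg]; split=> // x sx;
  by apply: Qs; rewrite ?s12 // -s12.
Qed.

Definition truncate f := f - lead_coef f *: 'X^((size f).-1).

Lemma size_truncate f : f != 0 -> (size (truncate f) < size f)%N.
Proof.
move=> f0.
have size_f : (size f).-1.+1 = size f.
  by rewrite prednK ?size_poly_gt0.
rewrite -size_f ltnS; apply/leq_sizeP => j.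
rewrite leq_eqVlt coefB coefZ coefXn.
case/orP=> [/eqP<-|lt_j]; first by rewrite eqxx mulr1 subrr.
by rewrite gtn_eqF // mulr0 subr0 nth_default // -size_f.
Qed.

(** The two polynomials differ by a multiple of [lead_coef f], which lies in every prime
    considered. *)
Lemma polyC_image_vanishing_lead f s g :
  [set P : spec R | P (lead_coef f)] `&` img (f :: s) g
  = [set P : spec R | P (lead_coef f)] `&` img (truncate f :: s) g.
Proof.
have QE (Q : spec {poly R}) : comap polyC Q (lead_coef f) ->
    Q (truncate f) <-> Q f.
  move=> Qa; apply: ideal_subl; rewrite opprB addrC subrK.
  by rewrite -mul_polyC; apply: ideal_mulr.
apply/seteqP; split=> P /= [Pa [Q [Qs nQg] QP]]; (split=> //; exists Q => //);
  rewrite -QP in Pa; split=> // x; rewrite in_cons => /orP[/eqP->|sx].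
- by apply/QE => //; apply: Qs; rewrite mem_head.
- by apply: Qs; rewrite in_cons sx orbT.
- by apply/QE => //; apply: Qs; rewrite mem_head.
- by apply: Qs; rewrite in_cons sx orbT.
Qed.

(** A step of the Euclidean algorithm, valid where the leading coefficient of the divisor is
    nonzero. *)
Lemma polyC_image_rmodp f1 f2 s g :
  basic_open (lead_coef f1) `&` img (f1 :: f2 :: s) g
  = basic_open (lead_coef f1) `&` img (f1 :: rmodp f2 f1 :: s) g.
Proof.
apply/seteqP; split=> P /= [Pa [Q [Qs nQg] QP]]; (split=> //; exists Q => //);
  rewrite -QP in Pa; split=> // x; rewrite !in_cons;
  (have Qf1 : Q f1 by apply: Qs; rewrite mem_head);
  case/or3P=> [/eqP-> //|/eqP->|sx];
  try (by apply: Qs; rewrite !in_cons sx !orbT).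
- by apply/rmodp_in_point => //; apply: Qs; rewrite !in_cons eqxx orbT.
- by apply/(rmodp_in_point f2 Pa Qf1); apply: Qs; rewrite !in_cons eqxx orbT.
Qed.

Lemma set_split (T : Type) (A E : set T) : E = (A `&` E) `|` (~` A `&` E).
Proof. by rewrite -setIUl setUCr setTI. Qed.

(** Induction on the sum of the sizes, each increased by one so that dropping a zero polynomial also
    counts as progress. *)
Lemma fc_polyC_image s g : fconstructible (img s g).
Proof.
have [N] := ubnP (\sum_(f <- s) (size f).+1); elim: N s => // N IHN s.
(* The closed part, where the leading coefficient vanishes, is settled by truncating [f]; only the
   open part is left to treat. *)
have lead_split f s' :
    fconstructible (basic_open (lead_coef f) `&` img (f :: s') g) ->
    (\sum_(h <- f :: s') (size h).+1 < N.+1)%N -> f != 0 ->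
    fconstructible (img (f :: s') g).
  move=> fc_open; rewrite big_cons => lt_N f0.
  rewrite (set_split (basic_open (lead_coef f)) (img _ _)).
  apply: fc_setU => //.
  have -> : ~` basic_open (lead_coef f) = [set P : spec R | P (lead_coef f)].
    by apply/seteqP; split=> P /= => [/contrapT|? ].
  rewrite polyC_image_vanishing_lead; apply: fc_setI; first exact: fc_vanish.
  apply: IHN; rewrite big_cons -ltnS; apply: leq_trans lt_N.
  by rewrite ltnS ltn_add2r ltnS size_truncate.
case: s => [|f1 [|f2 s]] lt_N.
- by rewrite polyC_image_nil; apply: fc_exists => i _; apply: fc_basic.
- have [f0|f0] := eqVneq f1 0.
    rewrite f0 polyC_image_zero;
    apply: IHN; rewrite -ltnS; apply: leq_trans lt_N.
    by rewrite !big_cons ltnS addSn ltnS leq_addl.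
  apply: lead_split => //; rewrite polyC_image_single.
  apply: fc_setI (fc_basic _) _.
  by apply: fc_exists => i _; apply: fc_basic.
(* The longer polynomial is divided by the shorter one, so the remainder is strictly shorter than
   what it replaces. *)
have reduce h1 h2 :
    (\sum_(h <- h1 :: h2 :: s) (size h).+1 < N.+1)%N ->
    (size h1 <= size h2)%N -> fconstructible (img (h1 :: h2 :: s) g).
  move=> lt_N' le_h; have [h0|h0] := eqVneq h1 0.
    rewrite h0 polyC_image_zero;
    apply: IHN; rewrite -ltnS; apply: leq_trans lt_N'.
    by rewrite !big_cons ltnS addSn ltnS leq_addl.
  apply: lead_split => //; rewrite polyC_image_rmodp.
  apply: fc_setI; first exact: fc_basic.
  apply: IHN; rewrite -ltnS; apply: leq_trans lt_N'; rewrite !big_cons.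
  rewrite ltnS ltn_add2l ltn_add2r ltnS (leq_trans _ le_h) //.
  by rewrite Pdiv.Ring.ltn_rmodp.
have [le_f|/ltnW le_f] := leqP (size f1) (size f2); first exact: reduce.
have swap : img (f1 :: f2 :: s) g = img (f2 :: f1 :: s) g.
  by apply: polyC_image_perm => x; rewrite !in_cons orbCA.
rewrite swap; apply: reduce => //.
by move: lt_N; rewrite !big_cons addnCA.
Qed.

End PolyStep.

Lemma chevalley_polyC (R : comNzRingType) : chevalley (@polyC R).
Proof. by apply: chevalley_basic => s g; apply: fc_polyC_image. Qed.

(** * Polynomial rings in several variables *)

Lemma mpoly_ring_ind (n : nat) (R : comNzRingType)
    (P : {mpoly R[n]} -> Prop) :
  (forall c, P c%:MP) -> (forall i, P 'X_i) ->
  (forall p q, P p -> P q -> P (p + q)) ->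
  (forall p q, P p -> P q -> P (p * q)) -> forall p, P p.
Proof.
move=> PC PX PD PM; elim/mpolyind => [|c m p _ _ Pp].
  by rewrite -(mpolyC0 n R); apply: PC.
apply: (PD) => //; rewrite -mul_mpolyC; apply: (PM) => //.
rewrite mpolyXE_id; elim/big_ind: _ => // [|i _]; first by rewrite -mpolyC1.
elim: (m i) => [|d IHd]; first by rewrite expr0 -mpolyC1.
by rewrite exprS; apply: PM.
Qed.

Lemma mpoly_rmorph_ext (n : nat) (R : comNzRingType) (S : comPzRingType)
    (f g : {rmorphism {mpoly R[n]} -> S}) :
  (forall c, f c%:MP = g c%:MP) -> (forall i, f 'X_i = g 'X_i) -> f =1 g.
Proof.
move=> fgC fgX; elim/mpoly_ring_ind => // p q fgp fgq.
  by rewrite !rmorphD fgp fgq.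
by rewrite !rmorphM fgp fgq.
Qed.

Section MpolyRetract.
Variables (n : nat) (R : comNzRingType).

Lemma meval0K : cancel (@meval 0 R (fun=> 0)) (@mpolyC 0 R).
Proof.
move=> p; have := @mpoly_rmorph_ext 0 R {mpoly R[0]}
  (@mpolyC 0 R \o @meval 0 R (fun=> 0)) idfun.
by apply=> [c|[]//] /=; rewrite mevalC.
Qed.

Definition mpoly_of_poly : {rmorphism {poly {mpoly R[n]}} -> {mpoly R[n.+1]}} :=
  horner_morph (fun a => mulrC ('X_ord_max) (mwiden a)).

Lemma muniK : cancel (@muni n R) mpoly_of_poly.
Proof.
move=> p; have := @mpoly_rmorph_ext n.+1 R {mpoly R[n.+1]}
  (mpoly_of_poly \o @muni n R) idfun.
apply=> [c|i] /=.
  by rewrite muniC /mpoly_of_poly /= horner_morphC /= mwidenC.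
(* Under [muni] the last variable becomes ['X], every other one a constant. *)
rewrite /muni mmapX mmap1U; case: splitP => j /= ej.
  rewrite /mpoly_of_poly /= horner_morphC /= mwidenX mnmwiden1.
  by congr 'X_[U_(_)]; apply/val_inj.
rewrite /mpoly_of_poly /= horner_morphX; congr 'X_[U_(_)]; apply/val_inj => /=.
by rewrite ej ord1 addn0.
Qed.

End MpolyRetract.

(** The variables are projected away one at a time. *)
Lemma chevalley_mpolyC (n : nat) (R : comNzRingType) : chevalley (@mpolyC n R).
Proof.
elim: n => [|n IHn].
  apply: (chevalley_retract (@meval0K R) _ (@chevalley_id R)) => c /=.
  by rewrite mevalC.
apply: (chevalley_retract (@muniK n R) _
  (chevalley_comp IHn (@chevalley_polyC _))).
by move=> c /=; rewrite muniC.
Qed.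

(** * Noetherianity *)

(** As the intersection of all ideals containing [s], it requires no explicit linear
    combinations. *)
Definition generated_ideal (R : comPzRingType) (s : seq R) : ideal R.
Proof.
exists (fun x => forall J : ideal R, (forall y, y \in s -> J y) -> J x).
- by move=> J _; apply: ideal_has0.
- by move=> x y Ix Iy J sJ; apply: ideal_add; [apply: Ix|apply: Iy].
- by move=> a x Ix J sJ; apply: ideal_mul; apply: Ix.
Defined.

Lemma mem_generated (R : comPzRingType) (s : seq R) x :
  x \in s -> generated_ideal s x.
Proof. by move=> sx J; apply. Qed.

Definition noetherian (R : comPzRingType) : Prop :=
  forall I : ideal R, exists s : seq R, forall x, I x <-> generated_ideal s x.

Lemma noetherian_surj (R S : comPzRingType) (h : S -> R)
    (r : {rmorphism R -> S}) : cancel h r -> noetherian R -> noetherian S.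
Proof.
move=> hK nR I; have [s Is] := nR (comap_ideal r I).
exists (map r s) => x; split=> [Ix J sJ|].
  rewrite -[x]hK; have /Is/(_ (comap_ideal r J)) : comap_ideal r I (h x).
    by rewrite /= /preimage /= hK.
  by apply=> y sy; apply: sJ; apply: map_f.
apply=> _ /mapP[y sy ->]; by have /Is := mem_generated sy.
Qed.

Lemma noetherian_field (k : fieldType) : noetherian k.
Proof.
move=> I; have [[x Ix x0]|nI] := pselect (exists2 x, I x & x != 0).
  exists [:: x] => y; split=> [_ J xJ|]; last by apply=> z /[!inE]/eqP->.
  by rewrite -[y](divfK x0); apply: ideal_mul; apply: xJ; rewrite mem_head.
exists [::] => x; split=> [Ix J _|]; last by apply.
have [->|x0] := eqVneq x 0; first exact: ideal_has0.
by case: nI; exists x.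
Qed.

(** The witness lists for the members of [s] are concatenated; monotonicity of [Q] keeps each of
    them valid. *)
Lemma seq_choice (T U : eqType) (s : seq T) (Q : T -> seq U -> Prop) :
  (forall x r r', Q x r -> {subset r <= r'} -> Q x r') ->
  forall D : U -> Prop,
  (forall x, x \in s -> exists2 r, (forall y, y \in r -> D y) & Q x r) ->
  exists2 r, (forall y, y \in r -> D y) & forall x, x \in s -> Q x r.
Proof.
move=> Qmono D; elim: s => [|x s IHs] sQ; first by exists [::].
have [r rD Qr] := IHs (fun y sy => sQ y (@mem_behead _ (x :: s) y sy)).
have [r' rD' Qr'] := sQ x (mem_head _ _); exists (r' ++ r).
  by move=> y; rewrite mem_cat => /orP[/rD'|/rD].
move=> y; rewrite in_cons => /orP[/eqP->|/Qr /Qmono]; last first.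
  by apply=> z rz; rewrite mem_cat rz orbT.
by apply: Qmono Qr' _ => z rz; rewrite mem_cat rz.
Qed.

Lemma generated_mono (R : comPzRingType) (r r' : seq R) x :
  generated_ideal r x -> {subset r <= r'} -> generated_ideal r' x.
Proof. by move=> rx rr' J r'J; apply: rx => y /rr'; apply: r'J. Qed.

(** Finitely many generators of the ideal spanned by [S] may lie outside [S], but each depends on
    finitely many elements of [S]; these are collected. *)
Lemma noetherian_finite_subset (R : comPzRingType) (S : set R) :
  noetherian R ->
  exists2 s : seq R, (forall x, x \in s -> S x) &
    forall J : ideal R, (forall x, x \in s -> J x) -> forall x, S x -> J x.
Proof.
move=> nR.
pose inI x :=
  exists2 r : seq R, (forall y, y \in r -> S y) & generated_ideal r x.
have I0 : inI 0 by exists [::] => //; apply: ideal_has0.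
have ID x y : inI x -> inI y -> inI (x + y).
  case=> [r rS rx] [r' rS' rx']; exists (r ++ r').
    by move=> z; rewrite mem_cat => /orP[/rS|/rS'].
  apply: ideal_add; [apply: generated_mono rx _|apply: generated_mono rx' _];
    by move=> z rz; rewrite mem_cat rz ?orbT.
have IM a x : inI x -> inI (a * x).
  by case=> r rS rx; exists r => //; apply: ideal_mul.
have [t It] := nR (Ideal I0 ID IM).
have [s sS st] : exists2 s : seq R, (forall y, y \in s -> S y) &
    forall x, x \in t -> generated_ideal s x.
  apply: seq_choice => [x r r'|x tx]; first exact: generated_mono.
  by have /It := mem_generated tx.
exists s => // J sJ x Sx.
have /It/(_ J) : inI x.
  by exists [:: x]; [move=> y /[!inE]/eqP->|apply/mem_generated/mem_head].
by apply=> y /st; apply.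
Qed.

Section HilbertBasis.
Variable R : comNzRingType.
Implicit Types (I J : ideal {poly R}) (d : nat).

(** The leading coefficients in degree [d]; bounding the size instead of fixing it includes 0 and
    gives closure under sums. *)
Definition lead_ideal I d : ideal R.
Proof.
exists (fun a => exists2 f : {poly R}, I f & (size f <= d.+1)%N /\ f`_d = a).
- by exists 0; [exact: ideal_has0|rewrite size_poly0 coef0].
- move=> x y [f If [sf <-]] [g Ig [sg <-]]; exists (f + g).
    exact: ideal_add.
  by rewrite coefD (leq_trans (size_polyD _ _)) // geq_max sf.
- move=> a x [f If [sf <-]]; exists (a *: f); last first.
    by rewrite coefZ (leq_trans (size_scale_leq _ _)).
  by rewrite -mul_polyC; apply: ideal_mul.
Defined.

Lemma lead_ideal_leq I d e a :
  (d <= e)%N -> lead_ideal I d a -> lead_ideal I e a.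
Proof.
move=> le_de [f If [sf <-]]; exists (f * 'X^(e - d)); first exact: ideal_mulr.
split; last by rewrite coefMXn ltnNge leq_subr /= subKn.
rewrite (leq_trans (size_polyMleq _ _)) // size_polyXn addnS /=.
by rewrite -(subnKC le_de) addKn -addSn leq_add2r.
Qed.

(** An element of [J] with the same leading term is subtracted from [f]; the difference stays in [I]
    and is shorter. *)
Lemma lead_ideal_sub I J : (forall f, J f -> I f) ->
  (forall d a, lead_ideal I d a -> lead_ideal J d a) -> forall f, I f -> J f.
Proof.
move=> sJI leadIJ f.
have [n] := ubnP (size f); elim: n f => // n IHn f le_fn If.
have [->|f0] := eqVneq f 0; first exact: ideal_has0.
have size_f : (size f).-1.+1 = size f.
  by rewrite prednK ?size_poly_gt0.
have [|h Jh [sh eh]] := leadIJ (size f).-1 f`_((size f).-1).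
  by exists f => //; rewrite size_f.
rewrite -(subrK h f); apply: ideal_add => //; apply: IHn; last first.
  by apply: ideal_sub => //; apply: sJI.
rewrite -ltnS (leq_trans _ le_fn) // ltnS -size_f ltnS.
apply/leq_sizeP => j; rewrite leq_eqVlt coefB => /orP[/eqP<-|lt_j].
  by rewrite eh subrr.
by rewrite !nth_default ?subr0 // ?(leq_trans sh) // -size_f.
Qed.

(** The increasing chain of leading ideals is stationary from some [N] on, as its union is finitely
    generated. Elements of [I] realising generators of the ideals in degrees up to [N] then generate
    [I]. *)
Lemma hilbert_basis : noetherian R -> noetherian {poly R}.
Proof.
move=> nR I.
have [N leadN] : exists N, forall d a, lead_ideal I d a -> lead_ideal I N a.
  pose inU a := exists d, lead_ideal I d a.
  have U0 : inU 0 by exists 0; apply: ideal_has0.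
  have UD x y : inU x -> inU y -> inU (x + y).
    case=> d dx [e ey]; exists (maxn d e); apply: ideal_add.
      exact: lead_ideal_leq (leq_maxl _ _) dx.
    exact: lead_ideal_leq (leq_maxr _ _) ey.
  have UM a x : inU x -> inU (a * x) by case=> d dx; exists d; apply: ideal_mul.
  have [t Ut] := nR (Ideal U0 UD UM).
  have [N tN] : exists N, forall a, a \in t -> lead_ideal I N a.
    have : forall a, a \in t -> inU a by move=> a /mem_generated/Ut.
    elim: (t) => [|a s IHs] sU; first by exists 0.
    have [N sN] := IHs (fun b sb => sU b (@mem_behead _ (a :: s) b sb)).
    have [M aM] := sU a (mem_head _ _); exists (maxn N M) => b.
    rewrite in_cons => /orP[/eqP->|/sN].
      exact: lead_ideal_leq (leq_maxr _ _) aM.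
    exact: lead_ideal_leq (leq_maxl _ _).
  by exists N => d a da; have /Ut/(_ _ tN) : inU a by exists d.
have [s sI sL] : exists2 s : seq {poly R}, (forall f, f \in s -> I f) &
    forall d, d \in iota 0 N.+1 ->
      forall a, lead_ideal I d a -> lead_ideal (generated_ideal s) d a.
  apply: seq_choice => [d r r' rL rr' a /rL [f rf ?]|d _].
    by exists f => //; apply: generated_mono rf rr'.
  have [t It] := nR (lead_ideal I d).
  have [r rI rt] : exists2 r : seq {poly R}, (forall f, f \in r -> I f) &
      forall a, a \in t -> lead_ideal (generated_ideal r) d a.
    apply: seq_choice => [a r r' [f rf ?] rr'|a /mem_generated/It[f If fa]].
      by exists f => //; apply: generated_mono rf rr'.
    exists [:: f]; first by move=> g /[!inE]/eqP->.
    by exists f => //; apply/mem_generated/mem_head.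
  by exists r => // a /It; apply.
exists s => f; split; last by apply.
apply: lead_ideal_sub => [g|d a da]; first by apply.
have [le_dN|/ltnW lt_Nd] := leqP d N; first by apply: sL; rewrite // mem_iota.
(* Above degree [N], the coefficient already occurs in degree [N] and is shifted up by a power of
   ['X]. *)
apply: lead_ideal_leq lt_Nd _; apply: sL; last exact: leadN da.
by rewrite mem_iota ltnS leqnn.
Qed.

End HilbertBasis.

Lemma noetherian_mpoly (n : nat) (k : fieldType) : noetherian {mpoly k[n]}.
Proof.
elim: n => [|n IHn].
  exact: noetherian_surj (@meval0K k) (@noetherian_field k).
exact: noetherian_surj (@muniK n k) (hilbert_basis IHn).
Qed.

(** * The graph of a rational map *)

Lemma fc_zero_locus (R : comPzRingType) (S : set R) :
  noetherian R -> fconstructible (zero_locus S).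
Proof.
move=> nR; have [s sS sJ] := noetherian_finite_subset S nR.
have -> : zero_locus S
          = [set P | forall x, x \in s -> [set Q : spec R | Q x] P].
  by apply/seteqP; split=> P /= SP; [move=> x /sS; apply: SP|exact: sJ].
by apply: fc_forall => x _; apply: fc_vanish.
Qed.

Lemma fc_constructible (R : comPzRingType) (E : set (spec R)) :
  noetherian R -> constructible E -> fconstructible E.
Proof.
move=> nR [r [L [lcL ->]]].
have -> : \bigcup_i L i = [set P | exists2 i, i \in enum 'I_r & L i P].
  by apply/seteqP; split=> P /= [i _ LP]; exists i; rewrite //= mem_enum.
apply: fc_exists => i _; have [U [Z [oU cZ ->]]] := lcL i.
have fc_open (V : set (spec R)) : open V -> fconstructible V.
  by case=> S ->; apply/fc_setC/fc_zero_locus.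
apply: fc_setI; first exact: fc_open.
by rewrite -[Z]setCK; apply/fc_setC/fc_open; rewrite openC.
Qed.

Section Surjection.
Variables (R S : comPzRingType) (f : {rmorphism R -> S}) (h : S -> R).
Hypothesis hK : cancel h f.

Lemma comap_surj_inj : injective (comap f).
Proof.
move=> P Q ePQ; apply: spec_ext => y; rewrite -[y]hK.
by rewrite -[X in X <-> _]/(comap f P (h y)) ePQ.
Qed.

(** Since [P] contains the kernel of [f], membership in [P] depends only on the value of [f]; so the
    preimage of [P] under the set-theoretic section [h] is a prime ideal. *)
Lemma comap_surj_image (P : spec R) :
  (forall x, f x = 0 -> P x) -> exists Q, comap f Q = P.
Proof.
move=> fP.
have PE x y : f x = f y -> P x -> P y.
  move=> fxy; have Pyx : P (y - x) by apply: fP; rewrite rmorphB fxy subrr.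
  exact: (ideal_subl Pyx).1.
have Q0 : P (h 0) by apply: fP; rewrite hK.
have QD x y : P (h x) -> P (h y) -> P (h (x + y)).
  move=> Px Py; apply: PE (ideal_add Px Py).
  by rewrite rmorphD !hK.
have QM a x : P (h x) -> P (h (a * x)).
  move=> Px; apply: PE (ideal_mul (h a) Px).
  by rewrite rmorphM !hK.
have Q1 : ~ P (h 1).
  by move/(PE _ 1); rewrite hK rmorph1 => /(_ erefl); apply: spec_proper.
have Qp x y : P (h (x * y)) -> P (h x) \/ P (h y).
  move/(PE _ (h x * h y)); rewrite rmorphM !hK => /(_ erefl).
  exact: spec_prime.
exists (@Spec _ (@Ideal _ (fun y => P (h y)) Q0 QD QM) Q1 Qp).
apply: spec_ext => x; rewrite /= /preimage /=.
by split; apply: PE; rewrite hK.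
Qed.

(** The map [comap f] is a bijection onto the closed set [K], so taking images commutes with
    complements relative to [K]. *)
Lemma chevalley_surj : noetherian R -> chevalley f.
Proof.
move=> nR E; set K := zero_locus [set x | f x = 0].
have fK : fconstructible K by apply: fc_zero_locus.
have imK Q : K (comap f Q).
  by move=> x /= fx; rewrite /preimage /= fx; apply: ideal_has0.
have imP P : K P -> exists Q, comap f Q = P by exact: comap_surj_image.
elim=> [g|F _ fF|F G _ fF _ fG].
- have -> : comap f @` basic_open g = K `&` basic_open (h g).
    apply/seteqP; split=> P /= => [[Q nQg <-]|[/imP[Q <-]]].
      by split=> //; rewrite /basic_open /= /preimage /= hK.
    by rewrite /basic_open /= /preimage /= hK => nQg; exists Q.
  exact: fc_setI (fc_basic _).
- have -> : comap f @` (~` F) = K `&` ~` (comap f @` F).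
    apply/seteqP; split=> P /= => [[Q nFQ <-]|[/imP[Q <-] nFQ]].
      by split=> // -[Q' FQ' /comap_surj_inj eQ]; apply: nFQ; rewrite -eQ.
    by exists Q => // FQ; apply: nFQ; exists Q.
  exact: fc_setI (fc_setC _).
- by rewrite image_setU; apply: fc_setU.
Qed.

End Surjection.

(** Two expressions of [b] agree after cross-multiplication, because [ratden b] is regular. The
    relation thus holds even where [s] vanishes at [P]. *)
Lemma ratfun_value_mul (A : comPzRingType) (b : ratfun A) (P : spec A)
    (v : residue_field P) (a s : A) :
  ratfun_value b v -> GRing.lreg s -> a * ratden b = ratnum b * s ->
  residue P s * v = residue P a.
Proof.
case=> a' [s' [s'reg ea' nPs' ->]] sreg ea.
have cross : a * s' = a' * s.
  apply: (@ratden_reg _ b).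
  by rewrite /= !mulrA ![ratden b * _]mulrC ea ea' mulrAC.
have s'0 : residue P s' != 0 by apply/eqP => /residue_eq0.
apply: (mulIf s'0); rewrite -mulrA divfK // -!rmorphM cross mulrC.
by [].
Qed.

Section FractionKernel.
Variables (m : nat) (k : comNzRingType) (B T : comPzRingType) (K : fieldType).
Variables (Q : spec T) (src : {rmorphism B -> T}) (e : {rmorphism B -> K}).
Variables (tgt : {rmorphism {mpoly k[m]} -> T}).
Variables (psi : {rmorphism {mpoly k[m]} -> K}).
Hypothesis QE : forall c, Q (src c) <-> e c = 0.

(* [psi h = e c / e d], and modulo [Q] also [tgt h = src c / src d]. *)
Let is_fraction (h : {mpoly k[m]}) := exists d c,
  [/\ ~ Q (src d), Q (src d * tgt h - src c) & e d * psi h = e c].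

(** Being a common fraction of elements of [B], modulo [Q] and in [K], is stable under sums and
    products, so it passes from generators to every [h]. Vanishing is then decided by the numerator,
    where [QE] applies. *)
Lemma mpoly_fraction_ker :
  (forall c, is_fraction c%:MP) -> (forall i, is_fraction 'X_i) ->
  forall h, Q (tgt h) <-> psi h = 0.
Proof.
move=> fracC fracX h; have [d [c [nd dc eh]]] : is_fraction h.
  elim/mpoly_ring_ind: h => // p q [d [c [nd dc ep]]] [d' [c' [nd' dc' eq]]].
    exists (d * d'), (c * d' + c' * d).
    rewrite !(rmorphM, rmorphD) -ep -eq; split.
    - by case/spec_prime.
    - have -> : src d * src d' * (tgt p + tgt q)
                - (src c * src d' + src c' * src d)
                = src d' * (src d * tgt p - src c)
                  + src d * (src d' * tgt q - src c') by ring.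
      by apply: ideal_add; apply: ideal_mul.
    - by ring.
  exists (d * d'), (c * c'); rewrite !rmorphM -ep -eq.
  split; last by rewrite mulrACA.
    by case/spec_prime.
  have -> : src d * src d' * (tgt p * tgt q) - src c * src c'
            = src d' * tgt q * (src d * tgt p - src c)
              + src c * (src d' * tgt q - src c') by ring.
  by apply: ideal_add; apply: ideal_mul.
have ed0 : e d != 0 by apply/eqP => /QE.
transitivity (Q (src d * tgt h)).
  by rewrite spec_mul; split=> [|[/nd|]]; [right| |].
have [QT TQ] := ideal_subl dc; split=> [/TQ|ph0].
  move/QE; rewrite -eh => /eqP; rewrite mulf_eq0 (negPf ed0).
  by move/eqP.
by apply/QT/QE; rewrite -eh ph0 mulr0.
Qed.

End FractionKernel.

Section Graph.
Variables (k : fieldType) (n m : nat) (X : affvar k n).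

Local Notation A := (coordring X).
Local Notation T := {mpoly {mpoly k[m]}[n]}.

Definition coordlift (x : A) : {mpoly k[n]} :=
  generic_quotient.repr (x : quotring (vanishing_ideal X)).

Lemma coordliftK : cancel coordlift (@coordproj k n X).
Proof. by move=> x; rewrite [RHS]quotproj_repr. Qed.

Lemma noetherian_coordring : noetherian A.
Proof. exact: noetherian_surj coordliftK (@noetherian_mpoly n k). Qed.

Lemma chevalley_coordproj : chevalley (@coordproj k n X).
Proof. exact: chevalley_surj coordliftK (@noetherian_mpoly n k). Qed.

(** Dual to the projection of the product of the two affine spaces to the source. The target
    coordinates serve as coefficients in [T], so that the other projection is covered by
    [chevalley_mpolyC]. *)
Definition source_coord : {rmorphism {mpoly k[n]} -> T} :=
  map_mpoly (@mpolyC m k).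

Definition target_coord : {rmorphism {mpoly k[m]} -> T} := @mpolyC n _.

Lemma source_coordC c : source_coord c%:MP = target_coord c%:MP.
Proof. exact: map_mpolyC. Qed.

Variables (P : spec A) (v : 'I_m -> residue_field P).

(** Evaluation at the pair of [P] and [v]; its kernel is the corresponding point of the graph. *)
Definition graph_eval : {rmorphism T -> residue_field P} :=
  mmap (mmap (scalar_at P) v) (fun i => residue P (coordproj X 'X_i)).

Lemma graph_eval_source h :
  graph_eval (source_coord h) = residue P (coordproj X h).
Proof.
apply: (mpoly_rmorph_ext (f := graph_eval \o source_coord)
  (g := residue P \o @coordproj k n X)) => [c|i] /=.
  by rewrite map_mpolyC /graph_eval /= !mmapC /= mmapC.
by rewrite /source_coord /= map_mpolyX /graph_eval /= mmapX mmap1U.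
Qed.

Lemma graph_eval_target h :
  graph_eval (target_coord h) = mmap (scalar_at P) v h.
Proof. by rewrite /graph_eval /= mmapC. Qed.

Lemma graph_eval_relation s a i :
  graph_eval (source_coord s * target_coord 'X_i - source_coord a)
  = residue P (coordproj X s) * v i - residue P (coordproj X a).
Proof.
rewrite (rmorphB graph_eval) (rmorphM graph_eval).
congr (_ * _ - _); [exact: graph_eval_source| |exact: graph_eval_source].
by rewrite graph_eval_target mmapX mmap1U.
Qed.

Lemma comap_graph_point :
  comap target_coord (ker_point graph_eval) = point_of_coords v.
Proof. by apply: spec_ext => h; rewrite /= /preimage /= graph_eval_target. Qed.

(** At [Q] each target coordinate is a fraction of source functions with value [v i], so
    [mpoly_fraction_ker] decides which target polynomials lie in [Q]. *)
Lemma comap_graph (Q : spec T) :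
  comap (@coordproj k n X) P = comap source_coord Q ->
  (forall i, exists s a, [/\ ~ Q (source_coord s),
     Q (source_coord s * target_coord 'X_i - source_coord a) &
     residue P (coordproj X s) * v i = residue P (coordproj X a)]) ->
  comap target_coord Q = point_of_coords v.
Proof.
move=> ePQ vQ; apply: spec_ext.
pose e : {rmorphism {mpoly k[n]} -> residue_field P} :=
  residue P \o @coordproj k n X.
pose psi : {rmorphism {mpoly k[m]} -> residue_field P} := mmap (scalar_at P) v.
apply: (@mpoly_fraction_ker m k _ _ _ Q source_coord e target_coord psi).
- move=> c; rewrite -[X in X <-> _]/(comap source_coord Q c) -ePQ.
  by symmetry; apply: residue_eq0.
- move=> c; exists 1, c%:MP; split; last by rewrite rmorph1 mul1r /psi /= mmapC.
    by rewrite rmorph1; apply: spec_proper.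
  by rewrite rmorph1 mul1r source_coordC subrr; apply: ideal_has0.
- move=> i; have [s [a [ns sa es]]] := vQ i; exists s, a; split=> //.
  by rewrite /psi /= mmapX mmap1U.
Qed.

End Graph.

(** * The image of a rational map *)

Section Image.
Variables (k : fieldType) (n m : nat) (X : affvar k n).
Variable b : 'I_m -> ratfun (coordring X).

Local Notation proj := (@coordproj k n X).
Local Notation src := (@source_coord k n m).
Local Notation tgt := (@target_coord k n m).

Definition expression (i : 'I_m) (s a : {mpoly k[n]}) : Prop :=
  GRing.lreg (proj s) /\ proj a * ratden (b i) = ratnum (b i) * proj s.

(** Among all denominators of [b i], finitely many have the same common zeros, so they already cover
    the domain of [b i]. *)
Lemma finite_denominators : exists (den : 'I_m -> seq {mpoly k[n]})
    (num : 'I_m -> {mpoly k[n]} -> {mpoly k[n]}),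
  (forall i s, s \in den i -> expression i s (num i s)) /\
  forall i (P : spec (coordring X)) (v : residue_field P),
    ratfun_value (b i) v ->
    exists2 s, s \in den i & ~ P (proj s).
Proof.
have /choice[den denE] i : exists r : seq {mpoly k[n]},
    (forall s, s \in r -> exists a, expression i s a) /\
    forall J : ideal {mpoly k[n]}, (forall s, s \in r -> J s) ->
      forall s, (exists a, expression i s a) -> J s.
  have [r rE rJ] := noetherian_finite_subset
    [set s | exists a, expression i s a] (@noetherian_mpoly n k).
  by exists r.
have /choice[num numE] (ix : 'I_m * {mpoly k[n]}) : exists a,
    ix.2 \in den ix.1 -> expression ix.1 ix.2 a.
  (* The value 0 is a filler for polynomials that are not listed denominators. *)
  case: ix => i s /=; have [sd|] := boolP (s \in den i); last by exists 0.
  by have [a Ea] := (denE i).1 s sd; exists a.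
exists den, (fun i s => num (i, s)).
split=> [i s|i P v]; first exact: (numE (i, s)).
(* If [P] contained all listed denominators, it would contain every denominator of [b i], including
   [s]. *)
case=> a [s [sreg ea nPs _]]; apply: contrapT => nden; apply: nPs.
rewrite -[s]coordliftK.
apply: ((denE i).2 (comap proj P)) => [s' s'd|].
  by apply: contrapT => nPs'; apply: nden; exists s'.
by exists (coordlift a); rewrite /expression !coordliftK.
Qed.

Lemma fc_ratfun_image (C : set (spec (coordring X))) : fconstructible C ->
  fconstructible [set Q | exists2 P, C P & ratfun_image b P Q].
Proof.
move=> fC; have [den [num [exprE denP]]] := finite_denominators.
pose defined := [set Q : spec {mpoly {mpoly k[m]}[n]} |
  forall i, i \in enum 'I_m ->
    [set Q' | exists2 s, s \in den i & basic_open (src s) Q'] Q].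
(* The equations are imposed for all listed denominators, also those vanishing at the point. *)
pose graph := [set Q : spec {mpoly {mpoly k[m]}[n]} |
  forall i, i \in enum 'I_m -> [set Q' : spec _ |
    forall s, s \in den i ->
      [set Q'' : spec _ | Q'' (src s * tgt 'X_i - src (num i s))] Q'] Q].
have fE : fconstructible
    (comap src @^-1` (comap proj @` C) `&` (defined `&` graph)).
  apply: fc_setI; first exact/fc_preimage/chevalley_coordproj.
  apply: fc_setI; apply: fc_forall => i _.
    by apply: fc_exists => s _; apply: fc_basic.
  by apply: fc_forall => s _; apply: fc_vanish.
have := chevalley_mpolyC fE; congr fconstructible.
apply/seteqP; split=> Q /=.
  case=> Q' [[P CP ePQ] [Qdef Qgraph]] <-; exists P => //.
  (* One denominator not vanishing at [Q'] is picked for each coordinate; it defines the value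
     [v i]. *)
  have /choice[s sP] i : exists s, s \in den i /\ ~ Q' (src s).
    by have [//|s sd nQs] := Qdef i; [rewrite mem_enum|exists s].
  have nP i : ~ P (proj (s i)).
    have := (sP i).2; rewrite -[X in ~ X -> _]/(comap src Q' (s i)) -ePQ.
    by [].
  have ns i : residue P (proj (s i)) != 0 by apply/eqP => /residue_eq0/nP.
  pose v i := residue P (proj (num i (s i))) / residue P (proj (s i)).
  exists v; split=> [i|].
    have [sreg ea] := exprE i (s i) (sP i).1.
    by exists (proj (num i (s i))), (proj (s i)).
  apply: comap_graph => // i; exists (s i), (num i (s i)); split.
  - exact: (sP i).2.
  - by apply: Qgraph; rewrite ?mem_enum //; apply: (sP i).1.
  - by rewrite /v mulrC divfK.
(* Conversely, the kernel of the evaluation at [P] and [v] is a point of the graph over both [P] and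
   its image. *)
case=> P CP [v [vP ->]]; exists (ker_point (graph_eval v)); last first.
  exact: comap_graph_point.
split; first exists P => //.
  apply: spec_ext => h; rewrite -[X in X <-> _]/(P (proj h)) -residue_eq0.
  by rewrite -(graph_eval_source v h).
split=> i _.
  have [s sd nPs] := denP i P _ (vP i); exists s => //.
  by rewrite /basic_open /= graph_eval_source residue_eq0.
move=> s sd; have [sreg ea] := exprE i s sd.
apply: (etrans (graph_eval_relation v s (num i s) i)).
by rewrite (ratfun_value_mul (vP i) sreg ea) subrr.
Qed.

End Image.

Theorem theorem1p0 (k : fieldType) (n m : nat) (X : affvar k n)
    (Y : affvar k m) (f : ratmap X Y) (C : set (spec (coordring X))) :
  constructible C -> constructible (ratmap_image f C).
Proof.
move=> /(fc_constructible (@noetherian_coordring k n X)) fC.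
have := constructible_fc (fc_ratfun_image f fC).
(* The image was computed in affine m-space; [ratmap_image] is its preimage under
   [ambient_point]. *)
exact: (constructible_preimage (coordproj Y)).
Qed.
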